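(* Let $\mathbf{p}=(p_1,\dots,p_n)$ be a probability distribution with all $p_i>0$, $Z>0$ an integer, and $g:(0,\infty)\to\mathbb{R}$ convex with $g(1)=0$; for $\mathbf{W}\in\mathbb{Z}_{\ge0}^n$ put $\Delta_g(\mathbf{p},\mathbf{W}):=\sum_{i=1}^np_i\,g\!\left(\frac{W_i}{Zp_i}\right)$. Let $t<Z$ be a positive integer and suppose $\mathbf{M}=(M_1,\dots,M_n)$ minimizes $\Delta_g(\mathbf{p},\cdot)$ over $\mathcal{M}[n,t]$. Let $$u\in\operatorname*{argmin}_{i=1,\dots,n}\ p_i\left[g\!\left(\frac{M_i+1}{Zp_i}\right)-g\!\left(\frac{M_i}{Zp_i}\right)\right],$$ and define $\mathbf{M}^+$ by $M^+_i:=M_i+\mathbf{1}_{i=u}$. Then $\mathbf{M}^+$ minimizes $\Delta_g(\mathbf{p},\cdot)$ over $\mathcal{M}[n,t+1]$.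
   Context: $\mathcal{M}[n,t]:=\{(W_1,\dots,W_n)\in\mathbb{Z}_{\ge0}^n:\sum_iW_i=t\}$. The value $g(0)$ is understood as $\lim_{s\to0^+}g(s)\in\mathbb{R}\cup\{+\infty\}$.
   Formalization: Added hypothesis: if t+1=n and g(0)=+∞, then all M_i≤1; without it the claim fails, e.g. n=Z=3, p uniform, g(s)=1/s−1, t=2, M=(2,0,0), u=2: M^+=(2,1,0) has cost +∞ but (1,1,1) has cost 0; in every excluded case the conclusion is false. *)

(* Defs.v *)
From HB Require Import structures.
From mathcomp Require Import all_boot all_order all_algebra.
From mathcomp Require Import all_classical all_reals all_analysis.

Set Implicit Arguments.
Unset Strict Implicit.
Unset Printing Implicit Defensive.

Import Order.TTheory GRing.Theory Num.Theory.
Import numFieldNormedType.Exports.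

Local Open Scope classical_set_scope.
Local Open Scope ring_scope.

Definition allocations (n t : nat) : set ('I_n -> nat) :=
  [set W | (\sum_(i < n) W i)%N = t].

Definition minimizes (R : realType) (T : Type) (A : set T) (f : T -> \bar R)
    (x : T) : Prop :=
  A x /\ forall y, A y -> (f x <= f y)%E.

(* [g] stands for a function on (0, +oo): its values on (-oo, 0] are never
   used, and its value at 0 is replaced by its right limit there.  This limit
   exists in \bar R and is not -oo when g is convex on (0, +oo). *)
Definition ext0 (R : realType) (g : R -> R) (s : R) : \bar R :=
  if s == 0 then lim ((g r)%:E @[r --> 0^'+]) else (g s)%:E.

Definition Delta (R : realType) (n Z : nat) (g : R -> R) (p : 'I_n -> R)
    (W : 'I_n -> nat) : \bar R :=
  (\sum_(i < n) (p i)%:E * ext0 g ((W i)%:R / (Z%:R * p i)))%E.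

(* Never of the form +oo - +oo: the first term of the difference is a value of
   g at a positive argument.  It is -oo when W i = 0 and g(0) = +oo. *)
Definition increment (R : realType) (n Z : nat) (g : R -> R) (p : 'I_n -> R)
    (W : 'I_n -> nat) (i : 'I_n) : \bar R :=
  ((p i)%:E * (ext0 g ((W i).+1%:R / (Z%:R * p i))
               - ext0 g ((W i)%:R / (Z%:R * p i))))%E.

(* Main.v *)
(* Each cost k |-> p_i g(k / (Z p_i)) is a convex sequence.  Let lam be the least
   increment at M, attained at u.  Optimality of M, tested by moving one unit
   from j to u, bounds the last decrement at every j by lam, so at M^+ the line
   of slope lam supports every cost sequence; summing these lower bounds over
   any W with total t + 1 gives the result.  If g(0) = +oo the same argument
   runs on counts >= 1, unless t < n; then an allocation of t + 1 units has
   finite cost only if it is (1,...,1), and for t + 1 = n this is M^+. *)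
Require Import Defs.
From HB Require Import structures.
From mathcomp Require Import all_boot all_order all_algebra.
From mathcomp Require Import all_classical all_reals all_analysis.
From mathcomp Require Import ring lra zify.
Import Order.TTheory GRing.Theory Num.Theory.
Import numFieldNormedType.Exports.
Local Open Scope classical_set_scope.
Local Open Scope ring_scope.

(** Increments grow with the index, so those right of [m] are at least [lam] and those left of it,
    down to [b], at most [lam]; summing them between [m] and [k] gives the bound. *)
Lemma discrete_convex_ge_tangent (R : realDomainType) (f : nat -> R) (b m : nat)
    (lam : R) :
  (forall k, (b <= k)%N -> f k.+1 - f k <= f k.+2 - f k.+1) ->
  (b <= m)%N -> lam <= f m.+1 - f m ->
  ((b < m)%N -> f m - f m.-1 <= lam) ->
  forall k, (b <= k)%N -> lam * (k%:R - m%:R) <= f k - f m.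
Proof.
move=> cvxf bm lamr laml k bk.
have right_slope j : (m <= j)%N -> lam <= f j.+1 - f j.
  elim: j => [|j IHj]; first by rewrite leqn0 => /eqP m0; rewrite -m0.
  rewrite leq_eqVlt => /predU1P[<- //|mj].
  by rewrite (le_trans (IHj mj))// cvxf// (leq_trans bm).
have left_slope d : (b + d < m)%N -> f (m - d)%N - f (m - d).-1 <= lam.
  elim: d => [|d IHd] bdm; first by rewrite subn0 laml// -(addn0 b).
  rewrite (le_trans _ (IHd _)) //; last by lia.
  have -> : (m - d)%N = (m - d.+2).+2 by lia.
  have -> : (m - d.+1)%N = (m - d.+2).+1 by lia.
  by apply: cvxf; lia.
have [mk|km] := leqP m k.
  rewrite -(subnKC mk); elim: (k - m)%N => [|d IHd]; first by rewrite addn0 !subrr mulr0.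
  have := right_slope (m + d)%N (leq_addr _ _).
  by rewrite addnS -natr1; move: IHd; rewrite !(mulrBr, mulrDr) mulr1; lra.
have [d -> {k bk km}] : exists2 d, k = (m - d)%N & (d <= m - b)%N.
  by exists (m - k)%N; lia.
elim: d => [|d IHd] dmb; first by rewrite subn0 !subrr mulr0.
have := left_slope d ltac:(lia); have := IHd ltac:(lia).
have -> : (m - d)%N = (m - d.+1).+1 by lia.
by rewrite /= -natr1 !(mulrBr, mulrDr) mulr1; lra.
Qed.

(** The finite-valued core of the argument, to be used with [b = 0] when g(0) is finite and with
    [b = 1] otherwise. *)
Lemma greedy_step_minimizes (R : realDomainType) (n b t : nat)
    (f : 'I_n -> nat -> R) (M : 'I_n -> nat) (u : 'I_n) :
  (forall i k, (b <= k)%N -> f i k.+1 - f i k <= f i k.+2 - f i k.+1) ->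
  (forall i, (b <= M i)%N) -> (\sum_i M i)%N = t ->
  (forall W : 'I_n -> nat, (forall i, (b <= W i)%N) -> (\sum_i W i)%N = t ->
    \sum_i f i (M i) <= \sum_i f i (W i)) ->
  (forall i, f u (M u).+1 - f u (M u) <= f i (M i).+1 - f i (M i)) ->
  forall W : 'I_n -> nat, (forall i, (b <= W i)%N) -> (\sum_i W i)%N = t.+1 ->
    \sum_i f i (M i + (i == u))%N <= \sum_i f i (W i).
Proof.
move=> cvxf bM Mt Mmin umin W bW Wt.
set lam := f u (M u).+1 - f u (M u).
have exchange j : j != u -> (b < M j)%N -> f j (M j) - f j (M j).-1 <= lam.
  move=> ju bMj; have uj : u != j by rewrite eq_sym.
  pose W' i := if i == u then (M u).+1 else if i == j then (M j).-1 else M i.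
  have W'M i : i != u -> i != j -> W' i = M i by rewrite /W' => /negPf-> /negPf->.
  have W'u : W' u = (M u).+1 by rewrite /W' eqxx.
  have W'j : W' j = (M j).-1 by rewrite /W' (negPf ju) eqxx.
  have := Mmin W'; rewrite !(bigD1 u isT) !(bigD1 j ju) /= W'u W'j.
  rewrite [X in _ <= _ + (_ + X)](eq_bigr (fun i => f i (M i))); last first.
    by move=> i /andP[? ?]; rewrite W'M.
  rewrite [X in (_ + (_ + X))%N](eq_bigr M); last first.
    by move=> i /andP[? ?]; rewrite W'M.
  move: Mt; rewrite (bigD1 u isT) (bigD1 j ju) /= => Mt.
  have bW' i : (b <= W' i)%N.
    by rewrite /W'; case: ifP => _; [rewrite leqW | case: ifP => _ //; lia].
  have W't : ((M u).+1 + ((M j).-1 +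
      \sum_(i < n | (i != u) && (i != j)) M i))%N = t.
    by rewrite -Mt -[in RHS](ltn_predK bMj) !(addSn, addnS).
  by move=> /(_ bW' W't); rewrite /lam; lra.
have tangent i :
    lam * ((W i)%:R - (M i + (i == u))%N%:R) <= f i (W i) - f i (M i + (i == u))%N.
  apply: (@discrete_convex_ge_tangent _ (f i) b) => //; first exact: cvxf.
  - exact: leq_trans (bM i) (leq_addr _ _).
  (* At [u] the point of contact is [(M u).+1]: the increment on its left is [lam] itself, and
     convexity bounds the one on its right. *)
  - have [->|iu] := eqVneq i u; last by rewrite addn0 umin.
    by rewrite addn1 cvxf.
  - have [->|iu] := eqVneq i u; first by rewrite addn1.
    by rewrite addn0; exact: exchange.
(* Both allocations have total [t.+1], so the linear terms sum to 0. *)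
have /ler_sum := fun i (_ : true) => tangent i.
move=> /(_ (index_enum _)); rewrite sumrB -mulr_sumr sumrB -!natr_sum Wt.
rewrite big_split /= Mt (bigD1 u isT) /= eqxx big1 => [|i /negPf -> //].
by rewrite addn0 addn1 subrr mulr0 subr_ge0.
Qed.

(** Convexity at the weight [(c - b) / (c - a)], cleared of denominators so that later uses are
    plain arithmetic. *)
Lemma convex_pos_chord (R : realType) (g : R -> R) (a b c : R) :
  @convex_function R R^o `]0, +oo[ g -> 0 < a -> a < b -> b < c ->
  (c - a) * g b <= (c - b) * g a + (b - a) * g c.
Proof.
move=> cvxg a0 ab bc; have ac : 0 < c - a by lra.
have t0 : 0 <= (c - b) / (c - a) by rewrite divr_ge0//; lra.
have t1 : (c - b) / (c - a) <= 1 by rewrite ler_pdivrMr//; lra.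
have convE : conv (Itv01 t0 t1) (a : convex_lmodType R^o) c = b.
  transitivity ((c - b) / (c - a) * a + (1 - (c - b) / (c - a)) * c); first by [].
  by field; rewrite gt_eqF.
have := cvxg (Itv01 t0 t1) a c; rewrite !inE /= !in_itv /= !andbT => /(_ a0 ltac:(lra)).
rewrite convE convRE /= /unstable.onem.
rewrite -(ler_pM2l ac) => /le_trans; apply.
by rewrite le_eqVlt; apply/orP; left; apply/eqP; field; rewrite gt_eqF.
Qed.

(* Near 0 write [g r = g 1 - (1 - r) * s r]; the slope [s] is nondecreasing, so
   it has a limit at 0+, which is not +oo. *)
Lemma convex_cvg_ext0 (R : realType) (g : R -> R) :
  @convex_function R R^o `]0, +oo[ g ->
  (g r)%:E @[r --> 0^'+] --> ext0 g 0 /\ ext0 g 0 != -oo%E.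
Proof.
move=> cvxg; pose s r := (g 1 - g r) / (1 - r).
have chord (a b c : R) := convex_pos_chord _ _ a b c cvxg.
have cvgg : cvg ((g r)%:E @[r --> 0^'+]).
  have := @nondecreasing_at_right_cvge R (EFin \o s) 0 (BLeft 1).
  rewrite bnd_simp => /(_ ltr01) cvgs.
  have {}cvgs := cvgs _; set S := ereal_inf _ in cvgs.
  have {}cvgs : (s r)%:E @[r --> 0^'+] --> S.
    apply: cvgs => x y; rewrite !in_itv /= => /andP[x0 x1] /andP[y0 y1].
    rewrite le_eqVlt => /predU1P[-> //|xy]; rewrite lee_fin /s.
    rewrite ler_pdivrMr ?subr_gt0// mulrAC ler_pdivlMr ?subr_gt0//.
    by have := chord x y 1 x0 xy y1; lra.
  have cvg1 : (1 - r)%:E @[r --> 0^'+] --> (1 : R)%:E.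
    apply: cvg_EFin; first by near=> r.
    rewrite -[X in _ --> X]subr0; apply: cvgB; first exact: cvg_cst.
    exact/cvg_at_right_filter/cvg_id.
  have cvgp : ((1 - r)%:E * (s r)%:E @[r --> 0%R^'+] --> 1%:E * S)%E.
    apply: cvgeM => //; rewrite /mule_def; case: S {cvgs} => //= *; exact: oner_neq0.
  have def1 : ((g 1)%:E +? - (1%:E * S))%E by exact: fin_num_adde_defr.
  have : ((g 1)%:E - (1 - r)%:E * (s r)%:E @[r --> 0%R^'+]
      --> (g 1)%:E - 1%:E * S)%E.
    by apply: cvgeD => //; [exact: cvg_cst | exact: cvgeN].
  move=> cvgd; apply: (cvgP ((g 1)%:E - 1%:E * S)%E).
  apply: cvg_trans cvgd; apply: near_eq_cvg; near=> r.
  have r1 : r < 1 by near: r; exact: nbhs_right_lt.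
  have gE : g r = g 1 - (1 - r) * s r.
    by rewrite /s; field; rewrite gt_eqF// subr_gt0.
  by rewrite /= gE.
split; first by rewrite /ext0 eqxx.
(* The chord over [r < 1 < 2] gives [g r >= (2 - r) * g 1 - (1 - r) * g 2], which this constant
   bounds below uniformly in [r]. *)
rewrite /ext0 eqxx -ltNye (@lt_le_trans _ _ (- `|g 1| *+ 2 - `|g 2|)%:E) ?ltNyr//.
apply: lime_ge => //; near=> r; rewrite lee_fin.
have r0 : 0 < r by near: r; exact: nbhs_right_gt.
have r1 : r < 1 by near: r; exact: nbhs_right_lt.
have := chord r 1 2 r0 r1 ltac:(lra).
have := ler_norm (g 2); have := ler_norm (- g 2); rewrite normrN.
have := ler_norm (g 1); have := ler_norm (- g 1); rewrite normrN.
nra.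
Unshelve. all: by end_near. Qed.

Lemma ext0_gt0 (R : realType) (g : R -> R) (s : R) :
  0 < s -> ext0 g s = (g s)%:E.
Proof. by move=> s0; rewrite /ext0 gt_eqF. Qed.

(** This is the chord inequality at three points with spacing [1 / q]. For [k = 0] the left point is
    outside the domain of convexity, so it is replaced by [r > 0] and [r] tends to 0; finiteness of
    the limit matters because [fine] sends infinite values to 0. *)
Lemma ext0_discrete_convex (R : realType) (g : R -> R) (q : R) (k : nat) :
  @convex_function R R^o `]0, +oo[ g -> 0 < q ->
  (0 < k)%N || (ext0 g 0 \is a fin_num) ->
  fine (ext0 g (k.+1%:R / q)) - fine (ext0 g (k%:R / q)) <=
  fine (ext0 g (k.+2%:R / q)) - fine (ext0 g (k.+1%:R / q)).
Proof.
move=> cvxg q0 kfin; have pos j : 0 < j.+1%:R / q by rewrite divr_gt0.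
have q'0 : 0 < q^-1 by rewrite invr_gt0.
have chord (a b c : R) := convex_pos_chord _ _ a b c cvxg.
rewrite !(ext0_gt0 _ _ _ (pos _)) /=.
rewrite -(ler_pM2l q'0).
case: k kfin => [/= gfin|k _]; last first.
  rewrite (ext0_gt0 _ _ _ (pos _)) /=.
  have := chord (k.+1%:R / q) (k.+2%:R / q) (k.+3%:R / q) (pos k).
  rewrite !ltr_pM2r// !ltr_nat => /(_ (ltnSn _) (ltnSn _)).
  rewrite -(natr1 k.+2) -(natr1 k.+1) !mulrDl !mul1r.
  by nra.
rewrite mul0r; have [cvgg _] := convex_cvg_ext0 _ _ cvxg.
have {cvgg gfin} cvgg : g r @[r --> 0^'+] --> fine (ext0 g 0).
  by move: cvgg; rewrite -{1}(fineK gfin) => /fine_cvgP[].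
have idr : r @[r --> (0 : R)^'+] --> 0 by exact/cvg_at_right_filter/cvg_id.
pose c := 2 / q; pose b := 1 / q.
have cE : c = 2 * q^-1 by [].
have bE : b = q^-1 by rewrite /b mul1r.
have cvgl : (c - r) * g b @[r --> (0 : R)^'+] --> (c - 0) * g b.
  by apply: cvgMl; apply: cvgB => //; exact: cvg_cst.
have cvgr : (c - b) * g r + (b - r) * g c @[r --> (0 : R)^'+] -->
    (c - b) * fine (ext0 g 0) + (b - 0) * g c.
  apply: cvgD; first exact: cvgMr.
  by apply: cvgMl; apply: cvgB => //; exact: cvg_cst.
have : (c - 0) * g b <= (c - b) * fine (ext0 g 0) + (b - 0) * g c.
  apply: (ler_cvg_to cvgl cvgr); near=> r; apply: chord => //.
    by near: r; apply: nbhs_right_lt; rewrite bE.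
  by rewrite cE bE; lra.
rewrite -/b -/c bE cE; nra.
Unshelve. all: by end_near. Qed.

Lemma eq_of_leq_sum (I : finType) (F G : I -> nat) :
  (forall i, F i <= G i)%N -> (\sum_i F i = \sum_i G i)%N -> F =1 G.
Proof.
move=> FG sFG i; have := leqif_sum (fun i (_ : true) => conj (FG i) erefl).
by move=> [_]; rewrite sFG eqxx => /esym/forallP/(_ i) /eqP.
Qed.

(* [hM1] excludes a corner where the conclusion fails.  It constrains M only if
   t + 1 = n and g(0) = +oo; then every W in M[n,t] has cost +oo, so every such
   W is a minimizer.  If moreover M i >= 2 for some i, then M^+ has a zero entry,
   hence cost +oo, whereas (1,...,1) in M[n,t+1] has finite cost. *)
Theorem theorem4p11 (R : realType) (n : nat) (p : 'I_n -> R)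
    (hp : forall i, 0 < p i) (hp1 : \sum_(i < n) p i = 1)
    (Z : nat) (hZ : (0 < Z)%N)
    (g : R -> R) (hg : @convex_function R R^o `]0, +oo[ g) (hg1 : g 1 = 0)
    (t : nat) (ht0 : (0 < t)%N) (htZ : (t < Z)%N)
    (M : 'I_n -> nat) (hM : minimizes (allocations t) (Delta Z g p) M)
    (hM1 : t.+1 = n -> ext0 g 0 = +oo%E -> forall i, (M i <= 1)%N)
    (u : 'I_n) (hu : minimizes [set: 'I_n] (increment Z g p M) u) :
  minimizes (allocations t.+1) (Delta Z g p)
    (fun i => (M i + (i == u))%N).
Proof.
have Zp0 i : 0 < Z%:R * p i by rewrite mulr_gt0// ltr0n.
have ext0S i k : ext0 g (k.+1%:R / (Z%:R * p i)) = (g (k.+1%:R / (Z%:R * p i)))%:E.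
  by rewrite ext0_gt0// divr_gt0.
have [[Mt Mmin] [_ umin]] := (hM, hu); rewrite /allocations /= in Mt.
have Mplust : (\sum_(i < n) (M i + (i == u)) = t.+1)%N.
  rewrite big_split /= Mt (bigD1 u isT) /= eqxx big1 => [|i /negPf -> //].
  by rewrite addn0 addn1.
pose cost i k := p i * fine (ext0 g (k%:R / (Z%:R * p i))).
(* The guard on [b] makes every count from [b] on have finite cost, where [cost] agrees with the
   true term. *)
have ext_fin b k i : (0 < b)%N || (ext0 g 0 \is a fin_num) -> (b <= k)%N ->
    ext0 g (k%:R / (Z%:R * p i)) \is a fin_num.
  case: k => [|k]; last by rewrite ext0S.
  by case: b => // gfin _; rewrite mul0r.
have DeltaE b W : (0 < b)%N || (ext0 g 0 \is a fin_num) ->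
    (forall i, (b <= W i)%N) -> Delta Z g p W = (\sum_i cost i (W i))%:E.
  move=> bfin bW; rewrite -sumEFin; apply: eq_bigr => i _.
  by rewrite /cost EFinM fineK//; apply: (ext_fin b).
have incrE b i : (0 < b)%N || (ext0 g 0 \is a fin_num) -> (b <= M i)%N ->
    increment Z g p M i = (cost i (M i).+1 - cost i (M i))%:E.
  move=> bfin bM; rewrite /cost -mulrBr EFinM EFinB !fineK//.
    exact: (ext_fin b).
  by apply: (ext_fin b) => //; exact: leqW.
have cost_convex b i k : (0 < b)%N || (ext0 g 0 \is a fin_num) -> (b <= k)%N ->
    cost i k.+1 - cost i k <= cost i k.+2 - cost i k.+1.
  move=> bfin bk; rewrite -!mulrBr ler_pM2l//; apply: ext0_discrete_convex => //.
  by case/orP: bfin => [b0|->]; rewrite ?orbT// (leq_trans b0).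
have finite_case b W : (0 < b)%N || (ext0 g 0 \is a fin_num) ->
    (forall i, (b <= M i)%N) -> (forall i, (b <= W i)%N) ->
    (\sum_i W i)%N = t.+1 ->
    (Delta Z g p (fun i => (M i + (i == u))%N) <= Delta Z g p W)%E.
  move=> bfin bM bW Wt; rewrite !(DeltaE b)//; last first.
    by move=> i; exact: leq_trans (bM i) (leq_addr _ _).
  rewrite lee_fin; apply: (@greedy_step_minimizes _ _ b t cost) => //.
  - by move=> i k; exact: cost_convex.
  - move=> V bV Vt; have := Mmin V Vt.
    by rewrite !(DeltaE b)// lee_fin.
  - by move=> i; have := umin i I; rewrite !(incrE b)// lee_fin.
split=> // W Wt; rewrite /allocations /= in Wt.
have [_ gNy] := convex_cvg_ext0 _ _ hg.
have [gfin|] := boolP (ext0 g 0 \is a fin_num).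
  by apply: (finite_case 0%N).
rewrite fin_numE gNy /= negbK => /eqP gy.
have DeltaNfin V : (exists i, V i = 0%N) -> Delta Z g p V = +oo%E.
  move=> [i Vi0]; apply/eqP; rewrite esum_eqy => [|j _].
    by apply/existsP; exists i; rewrite Vi0 mul0r gy gt0_muley ?lte_fin.
  case: (V j) => [|k]; first by rewrite mul0r gy gt0_muley ?lte_fin.
  by rewrite ext0S.
have [/existsP[i /eqP Wi0]|] := boolP [exists i, W i == 0%N].
  by rewrite (DeltaNfin W) ?leey//; exists i.
rewrite negb_exists => /forallP W0.
have {}W0 i : (0 < W i)%N by rewrite lt0n.
have sum1 : (\sum_(i < n) 1 = n)%N by rewrite sum1_card card_ord.
have nt1 : (n <= t.+1)%N by rewrite -Wt -[leqLHS]sum1 leq_sum.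
have [nt|tn] := leqP n t.
  apply: (finite_case 1%N) => // i; rewrite lt0n; apply/negP => /eqP Mi0.
  (* One unit everywhere and the surplus on [u]: a finite cost, which a minimizer with a zero entry
     could not match. *)
  pose V (j : 'I_n) := (1 + (t - n) * (j == u))%N.
  have Vt : (\sum_j V j = t)%N.
    rewrite big_split /= sum1 (bigD1 u isT) /= eqxx big1 => [|j /negPf -> //].
      by rewrite addn0 muln1 subnKC.
    by rewrite muln0.
  have := Mmin V Vt.
  by rewrite (DeltaNfin M) ?(DeltaE 1%N V)//; exists i.
have tn1 : t.+1 = n by apply/eqP; rewrite eqn_leq nt1 tn.
have Mle1 := hM1 tn1 gy.
(* As [t < n], some entry of [M] is 0 and has increment -oo, whereas a positive [M u] would make the
   least increment finite. *)
have Mu0 : M u = 0%N.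
  have [/existsP[j /eqP Mj0]|] := boolP [exists j, M j == 0%N]; last first.
    rewrite negb_exists => /forallP M0.
    have : (n <= t)%N by rewrite -Mt -[leqLHS]sum1 leq_sum// => j _; rewrite lt0n.
    by rewrite leqNgt tn.
  apply/eqP; rewrite -leqn0 leqNgt; apply/negP => Mu0.
  have := umin j I; rewrite (incrE 1%N u)// /increment Mj0 mul0r gy.
  by rewrite ext0S gt0_muleNy ?lte_fin.
suff -> : (fun i => (M i + (i == u))%N) = W by [].
(* Entries of the new allocation are at most 1, those of [W] at least 1, and the totals agree. *)
apply/funext/eq_of_leq_sum; last by rewrite Mplust.
move=> i; have [->|iu] := eqVneq i u; first by rewrite Mu0 W0.
by rewrite addn0 (leq_trans (Mle1 i)).
Qed.
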